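(* Let $n\ge2$ and let $\alpha$ be the gauge action of $\mathbb{S}^1$ on the Cuntz algebra $\mathcal{O}_n$. If $x\in\mathcal{O}_n$ is normal and of degree one, i.e. $\alpha_z(x)=zx$ for all $z\in\mathbb{S}^1$, then $x=0$. Consequently, the gauge action of $\mathbb{S}^1$ on $\mathcal{O}_n$ has infinite weak local-triviality dimension: $\mathrm{dim}^{\mathbb{S}^1}_{\mathrm{WLT}}(\mathcal{O}_n)=\infty$.
   Context: $\mathcal{O}_n$ is the universal $C^*$-algebra generated by $S_1,\ldots,S_n$ with $S_i^*S_i=1$ for all $i$ and $\sum_{i=1}^nS_iS_i^*=1$. The gauge action of $\mathbb{S}^1$ is $\alpha_z(S_i)=zS_i$. Weak local-triviality dimension: let a compact group $G$ act on a unital $C^*$-algebra $A$. Equip $C(G)$ with $(\alpha_gf)(h)=f(hg)$ and $C_0((0,1])\otimes C(G)$ with the action on the second factor, and let $t$ be the identity function in $C_0((0,1])$. $\mathrm{dim}^G_{\mathrm{WLT}}(A)$ is the smallest $m\ge0$ for which there exist $G$-equivariant $*$-homomorphisms $\rho_0,\ldots,\rho_m:C_0((0,1])\otimes C(G)\to A$ such that $\sum_{i=0}^m\rho_i(t\otimes1)$ is invertible ($\infty$ if no such $m$ exists). *)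

(* Defs.v *)
From HB Require Import structures.
From mathcomp Require Import all_boot all_order all_algebra complex.
From mathcomp Require Import all_classical all_reals all_analysis.
Import Order.TTheory GRing.Theory Num.Theory.
Import numFieldNormedType.Exports.

Set Implicit Arguments.
Unset Strict Implicit.
Unset Printing Implicit Defensive.

Local Open Scope classical_set_scope.
Local Open Scope ring_scope.
Local Open Scope complex_scope.

(* The library equips numFieldType sorts with their norm topology, but not the
   concrete type R[i]. *)
HB.instance Definition _ (R : realType) := GRing.ComAlgebra.copy R[i] R[i]^o.
HB.instance Definition _ (R : realType) := NormedModule.copy R[i] R[i]^o.

(* Unital C*-algebras over the complex numbers R[i].  The norm is a separate
   R-valued function because the library hierarchy has no join of rings that
   are not number domains with normed modules; for the same reason completeness
   and, below, closedness and continuity are spelled out through cnorm.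
   Being an algType, such an algebra satisfies 1 <> 0 (equivalently |1| = 1). *)
HB.mixin Record isCstarAlgebra (R : realType) A of GRing.Algebra R[i] A := {
  cnorm : A -> R;
  star : A -> A;
  cnorm_eq0 : forall x : A, cnorm x = 0 -> x = 0;
  cnormD : forall x y : A, cnorm (x + y) <= cnorm x + cnorm y;
  cnormZ : forall (a : R[i]) (x : A),
    (cnorm (a *: x))%:C = `|a| * (cnorm x)%:C;
  cnormM : forall x y : A, cnorm (x * y) <= cnorm x * cnorm y;
  cnorm_complete : forall u : nat -> A,
    (forall e : R, 0 < e -> exists N, forall p q,
       (N <= p)%N -> (N <= q)%N -> cnorm (u p - u q) < e) ->
    exists l : A, cnorm (u p - l) @[p --> \oo] --> (0 : R);
  starK : involutive star;
  starD : forall x y : A, star (x + y) = star x + star y;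
  starZ : forall (a : R[i]) (x : A), star (a *: x) = a^* *: star x;
  starM : forall x y : A, star (x * y) = star y * star x;
  cnorm_star : forall x : A, cnorm (star x * x) = cnorm x ^+ 2
}.

#[short(type="cstarAlgType")]
HB.structure Definition CstarAlgebra (R : realType) :=
  {A of GRing.Algebra R[i] A & isCstarAlgebra R A}.

Section CstarAlgebraDefs.
Variables (R : realType) (A : cstarAlgType R).

Definition normal_elt (x : A) := star x * x = x * star x.

Definition invertible (x : A) := exists y : A, x * y = 1 /\ y * x = 1.

Record closed_star_subalgebra (D : set A) : Prop := ClosedStarSubalgebra {
  subalg0 : D 0;
  subalgD : forall x y, D x -> D y -> D (x + y);
  subalgZ : forall (a : R[i]) x, D x -> D (a *: x);
  subalgM : forall x y, D x -> D y -> D (x * y);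
  subalg_star : forall x, D x -> D (star x);
  subalg_closed : forall x,
    (forall e : R, 0 < e -> exists2 y, D y & cnorm (x - y) < e) -> D x
}.

Definition cstar_generated (B : set A) : set A :=
  smallest closed_star_subalgebra B.

End CstarAlgebraDefs.

Section CuntzAlgebra.
Variables (R : realType) (n : nat).

Definition cuntz_family (A : cstarAlgType R) (S : 'I_n -> A) : Prop :=
  (forall i, star (S i) * S i = 1) /\ \sum_(i < n) S i * star (S i) = 1.

(* (A, S) is O_n with its canonical generators.  The homomorphism in
   cuntz_universal is unique because S generates A and *-homomorphisms are
   contractive. *)
Record is_cuntz_algebra (A : cstarAlgType R) (S : 'I_n -> A) : Prop :=
  IsCuntzAlgebra {
  cuntz_relations : cuntz_family S;
  cuntz_generated : cstar_generated (range S) = [set: A];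
  cuntz_universal : forall (B : cstarAlgType R) (T : 'I_n -> B),
    cuntz_family T -> exists phi : {lrmorphism A -> B},
      (forall x, phi (star x) = star (phi x)) /\ (forall i, phi (S i) = T i)
}.

End CuntzAlgebra.

HB.mixin Record isCompactTopologicalGroup G of Group G & Topological G := {
  mulg_continuous : continuous (fun p : G * G => (p.1 * p.2)%g);
  invg_continuous : continuous (fun g : G => g^-1%g);
  compact_setT : compact [set: G];
  hausdorff_setT : hausdorff_space G
}.

#[short(type="compactGroupType")]
HB.structure Definition CompactGroup :=
  {G of Group G & Topological G & isCompactTopologicalGroup G}.

Record circle (R : realType) := Circle {
  circle_val :> R[i];
  circle_valP : `|circle_val| == 1
}.

HB.instance Definition _ R := [isSub for @circle_val R].
HB.instance Definition _ R := [Choice of circle R by <:].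

Section CircleGroup.
Variable R : realType.
Implicit Types z w : circle R.

Let one : circle R := Circle (introT eqP (normr1 R[i])).
Fact circle_mulP z w : `|val z * val w| == 1.
Proof. by rewrite normrM (eqP (valP z)) (eqP (valP w)) mulr1. Qed.
Fact circle_invP z : `|(val z)^-1| == 1.
Proof. by rewrite normfV (eqP (valP z)) invr1. Qed.
Let mul z w := Circle (circle_mulP z w).
Let inv z := Circle (circle_invP z).
Fact circle_neq0 z : val z != 0.
Proof. by rewrite -normr_eq0 (eqP (valP z)) oner_eq0. Qed.
Fact circle_mulA : associative mul.
Proof. by move=> x y z; apply/val_inj; rewrite /= mulrA. Qed.
Fact circle_mul1z : left_id one mul.
Proof. by move=> x; apply/val_inj; rewrite /= mul1r. Qed.
Fact circle_mulz1 : right_id one mul.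
Proof. by move=> x; apply/val_inj; rewrite /= mulr1. Qed.
Fact circle_mulVz : left_inverse one inv mul.
Proof. by move=> x; apply/val_inj; rewrite /= mulVf ?circle_neq0. Qed.
Fact circle_mulzV : right_inverse one inv mul.
Proof. by move=> x; apply/val_inj; rewrite /= mulfV ?circle_neq0. Qed.
HB.instance Definition _ := isGroup.Build (circle R)
  circle_mulA circle_mul1z circle_mulz1 circle_mulVz circle_mulzV.
HB.instance Definition _ :=
  Topological.copy (circle R) (initial_topology (@circle_val R)).

Lemma circle_val_continuous : continuous (@circle_val R).
Proof. exact: (@initial_continuous (circle R) R[i] (@circle_val R)). Qed.

Lemma continuous_circle (T : topologicalType) (f : T -> circle R) :
  continuous (fun x => circle_val (f x)) -> continuous f.
Proof.
exact: (@continuous_comp_initial (circle R) T R[i] (@circle_val R) f).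
Qed.

Fact circle_mul_continuous :
  continuous (fun p : circle R * circle R => (p.1 * p.2)%g).
Proof.
apply: continuous_circle => -[z w] /=; apply: cvgM.
- apply: (cvg_comp fst (@circle_val R)); first exact: cvg_fst.
  exact: circle_val_continuous.
- apply: (cvg_comp snd (@circle_val R)); first exact: cvg_snd.
  exact: circle_val_continuous.
Qed.

Fact circle_inv_continuous : continuous (fun z : circle R => z^-1%g).
Proof.
apply: continuous_circle => z /=.
exact: (cvgV (circle_neq0 z) (@circle_val_continuous z)).
Qed.

Fact circle_hausdorff : hausdorff_space (circle R).
Proof.
move=> z w zw; apply/val_inj.
apply: (@norm_hausdorff _ R[i]) => U V Uz Vw.
have [x [Ux Vx]] := zw _ _ (circle_val_continuous Uz) (circle_val_continuous Vw).
by exists (val x).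
Qed.

Let expiP (t : R) : `|cos t +i* sin t| == 1.
Proof. by rewrite normc_def /= cos2Dsin2 sqrtr1. Qed.
Let expi (t : R) := Circle (expiP t).

Let expi_continuous : continuous expi.
Proof.
apply: continuous_circle => t /=.
have toC : continuous (real_complex R : R -> R[i]).
  move=> x; apply/cvgrPdist_lt => /= e e0.
  have eE : e = (complex.Re e)%:C by rewrite RRe_real// gtr0_real.
  have e1 : 0 < complex.Re e by rewrite -ltcR -eE.
  near=> y.
  rewrite -rmorphB normc_def /= expr0n/= addr0 sqrtr_sqr eE ltcR.
  near: y; exact: cvgr_dist_lt.
have -> : (fun x : R => cos x +i* sin x) =
          (fun x : R => (cos x)%:C + 'i * (sin x)%:C).
  by apply/funext => x; rewrite [LHS]complexE.
apply: cvgD.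
  by apply: (cvg_comp cos (real_complex R)); [exact: continuous_cos|exact: toC].
apply: cvgM; first exact: cvg_cst.
by apply: (cvg_comp sin (real_complex R)); [exact: continuous_sin|exact: toC].
Unshelve. all: by end_near.
Qed.

Fact circle_compact : compact [set: circle R].
Proof.
suff <- : expi @` `[- pi, pi]%classic = [set: circle R].
  apply: continuous_compact; last exact: segment_compact.
  exact: continuous_subspaceT expi_continuous.
apply/seteqP; split=> // -[[x y] xy] _ /=.
have xy1 : x ^+ 2 + y ^+ 2 = 1.
  move: (xy); rewrite normc_def /= => /eqP[] /(congr1 (fun r => r ^+ 2)).
  by rewrite sqr_sqrtr ?expr1n// addr_ge0 ?sqr_ge0.
have x1 : -1 <= x <= 1.
  rewrite -ler_norml -(@ler_pXn2r _ 2) ?nnegrE// real_normK ?num_real//.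
  by rewrite expr1n -xy1 lerDl sqr_ge0.
have y2 : 1 - x ^+ 2 = y ^+ 2 by rewrite -xy1 addrAC subrr add0r.
have [y0|y0] := leP 0 y.
- exists (acos x).
    by rewrite /= in_itv /= acos_lepi// (le_trans _ (acos_ge0 x1))// oppr_le0 pi_ge0.
  apply/val_inj; rewrite /= acosK ?in_itv//= sin_acos// y2 sqrtr_sqr.
  by rewrite ger0_norm.
- exists (- acos x).
    rewrite /= in_itv /= lerN2 acos_lepi// (le_trans _ (pi_ge0 _))//.
    by rewrite oppr_le0 acos_ge0.
  apply/val_inj; rewrite /= cosN sinN acosK ?in_itv//= sin_acos// y2 sqrtr_sqr.
  by rewrite ltr0_norm// opprK.
Qed.

HB.instance Definition _ := isCompactTopologicalGroup.Build (circle R)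
  circle_mul_continuous circle_inv_continuous circle_compact circle_hausdorff.
End CircleGroup.

(* Actions are strongly (point-norm) continuous. *)
Record cstar_action (R : realType) (G : compactGroupType)
    (A : cstarAlgType R) := CstarAction {
  act :> G -> {lrmorphism A -> A};
  act_star : forall g x, act g (star x) = star (act g x);
  act1 : forall x, act 1%g x = x;
  actM : forall g h x, act (g * h)%g x = act g (act h x);
  act_continuous : forall x g, cnorm (act h x - act g x) @[h --> g] --> (0 : R)
}.

Definition is_gauge_action (R : realType) n (A : cstarAlgType R)
    (S : 'I_n -> A) (alpha : cstar_action (circle R) A) : Prop :=
  forall z i, alpha z (S i) = circle_val z *: S i.

Section FunctionAlgebras.
Variable R : realType.

Definition C_continuous (X : topologicalType) : set (X -> R[i]) :=
  [set f | continuous f].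

Definition C_vanishing (X : topologicalType) : set (X -> R[i]) :=
  [set f | continuous f /\ forall e : R, 0 < e ->
     exists2 K : set X, compact K & forall x, ~ K x -> `|f x| < e%:C].

Definition pure_tensor (X Y : Type) (f : X -> R[i]) (g : Y -> R[i]) :
  X * Y -> R[i] := fun p => f p.1 * g p.2.

(* The C*-tensor product of two commutative C*-algebras D and E of bounded
   functions on X and Y: the algebraic tensor product, realised by functions on
   X * Y, completed in its (unique) C*-norm, which is the supremum norm. *)
Definition function_tensor (X Y : topologicalType)
    (D : set (X -> R[i])) (E : set (Y -> R[i])) : set (X * Y -> R[i]) :=
  closure ([set F | exists m (f : 'I_m -> X -> R[i]) (g : 'I_m -> Y -> R[i]),
      [/\ forall k, D (f k), forall k, E (g k) &
          F = (fun p => \sum_(k < m) pure_tensor (f k) (g k) p)]]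
    : set {uniform X * Y -> R[i]}).

(* rho restricts to a (not necessarily unital) *-homomorphism from the
   *-algebra D of functions to A; its values outside D are irrelevant. *)
Record star_hom_on (X : Type) (D : set (X -> R[i])) (A : cstarAlgType R)
    (rho : (X -> R[i]) -> A) : Prop := StarHomOn {
  star_homD : forall f g, D f -> D g ->
    rho (fun x => f x + g x) = rho f + rho g;
  star_homZ : forall (a : R[i]) f, D f -> rho (fun x => a * f x) = a *: rho f;
  star_homM : forall f g, D f -> D g ->
    rho (fun x => f x * g x) = rho f * rho g;
  star_homJ : forall f, D f -> rho (fun x => (f x)^*) = star (rho f)
}.

End FunctionAlgebras.

Section WeakLocalTriviality.
Variables (R : realType) (G : compactGroupType) (A : cstarAlgType R).
Variable alpha : cstar_action G A.

Definition half_open_unit : topologicalType := set_type `]0 : R, 1 : R]%classic.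

Definition half_open_id : half_open_unit -> R[i] := fun s => (val s)%:C.

Definition cone_tensor : set (half_open_unit * G -> R[i]) :=
  function_tensor (@C_vanishing R half_open_unit) (@C_continuous R G).

Definition second_translate (g : G) (f : half_open_unit * G -> R[i]) :
  half_open_unit * G -> R[i] := fun p => f (p.1, (p.2 * g)%g).

Definition wlt_bounded (m : nat) : Prop :=
  exists rho : 'I_m.+1 -> (half_open_unit * G -> R[i]) -> A,
    [/\ forall i, star_hom_on cone_tensor (rho i),
        forall i g f, cone_tensor f ->
          rho i (second_translate g f) = alpha g (rho i f) &
        invertible (\sum_(i < m.+1)
          rho i (pure_tensor half_open_id (fun _ => 1)))].

Definition dim_WLT : \bar R := ereal_inf [set m%:R%:E | m in wlt_bounded].

End WeakLocalTriviality.

(* Main.v *)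
(** Let [tr k y] be the sum of [|y S_mu|^2] over the words [mu] of length [k].
    The elements [u] with [tr k u / n^k -> 0] form a left ideal, stable under
    right multiplication by the [S_i] and [S_i^*], and [tr k x = tr k x^*] when
    [x] is normal.  If [y] is a linear combination of [S_mu S_nu^*] with
    [|mu| = k + 1] and [|nu| = k], both [tr k y] and [tr (k + 1) y^*] are the
    sum of the squared moduli of its coefficients.  A degree-one [x] is a limit
    of such [y], so for [x] normal [tr (k + 1) x] and [tr k x] differ by
    [o(n^k)], whence [tr k x / n^k -> 0].  The ideal meets the fixed-point
    algebra trivially, because the latter is a limit of full matrix algebras;
    hence [x^* x = 0].

    An equivariant homomorphism from the cone over [C(S^1)] sends [t (x) z],
    with [z] the inclusion of the circle in the plane, to a normal element of
    degree one, so it kills [t (x) z] and therefore [t (x) 1]. *)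

Require Import Defs.
From mathcomp Require Import all_boot all_order all_algebra complex.
From mathcomp Require Import all_classical all_reals all_analysis.
From mathcomp Require Import ring lra.
Import Order.TTheory GRing.Theory Num.Theory.
Import numFieldNormedType.Exports.
Local Open Scope classical_set_scope.
Local Open Scope ring_scope.
Local Open Scope complex_scope.

Set Implicit Arguments.
Unset Strict Implicit.
Unset Printing Implicit Defensive.

Lemma ler_add_eps (R : realType) (x y : R) :
  (forall e : R, 0 < e -> x <= y + e) -> x <= y.
Proof. by move=> xy; apply/ler_addgt0Pr. Qed.

Lemma splitr1 (R : realType) : 1 = 2^-1 + 2^-1 :> R.
Proof. by rewrite [LHS]splitr mul1r. Qed.

(** * Norm and involution of a C*-algebra *)

Section CstarNorm.
Variables (R : realType) (A : cstarAlgType R).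
Implicit Types (x y z : A) (a : R[i]) (r e : R).

Lemma cnormZE a x : cnorm (a *: x) = Normc.normc a * cnorm x.
Proof. by apply: complexI; rewrite cnormZ rmorphM. Qed.

Lemma cnormZr r x : cnorm (r%:C *: x) = `|r| * cnorm x.
Proof.
by rewrite cnormZE /Normc.normc /= expr0n /= addr0 sqrtr_sqr.
Qed.

Lemma cnormZ1 a x : `|a| = 1 -> cnorm (a *: x) = cnorm x.
Proof. by move=> a1; apply: complexI; rewrite cnormZ a1 mul1r. Qed.

Lemma cnorm0 : cnorm (0 : A) = 0.
Proof. by rewrite -(scale0r 0) (_ : 0 = (0 : R)%:C) ?cnormZr ?normr0 ?mul0r. Qed.

Lemma cnormN x : cnorm (- x) = cnorm x.
Proof. by rewrite -scaleN1r cnormZ1 // normrN normr1. Qed.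

Lemma cnorm_ge0 x : 0 <= cnorm x.
Proof.
have := cnormD x (- x); rewrite subrr cnorm0 cnormN -mulr2n.
by rewrite pmulrn_lge0.
Qed.

Lemma cnormB x y : cnorm (x - y) <= cnorm x + cnorm y.
Proof. by rewrite -(cnormN y); exact: cnormD. Qed.

Lemma cdistC x y : cnorm (x - y) = cnorm (y - x).
Proof. by rewrite -opprB cnormN. Qed.

Lemma cdist_tri y x z : cnorm (x - z) <= cnorm (x - y) + cnorm (y - z).
Proof. by apply: le_trans (cnormD _ _); rewrite addrA subrK. Qed.

Lemma cnorm_sum (I : Type) (s : seq I) (F : I -> A) :
  cnorm (\sum_(i <- s) F i) <= \sum_(i <- s) cnorm (F i).
Proof.
elim: s => [|i s IH]; first by rewrite !big_nil cnorm0.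
by rewrite !big_cons (le_trans (cnormD _ _))// lerD2l.
Qed.

Lemma cnorm_eps_eq0 x : (forall e, 0 < e -> cnorm x <= e) -> x = 0.
Proof.
move=> xe; apply/cnorm_eq0/le_anti; rewrite cnorm_ge0 andbT.
by apply: ler_add_eps => e e0; rewrite add0r xe.
Qed.

Lemma star1 : star 1 = 1 :> A.
Proof. by rewrite -[RHS]starK -[star 1 in RHS]mulr1 starM starK mulr1. Qed.

Lemma star0 : star 0 = 0 :> A.
Proof. by apply: (addrI (star 0)); rewrite -starD !addr0. Qed.

Lemma starN x : star (- x) = - star x.
Proof. by apply: (addrI (star x)); rewrite -starD !subrr star0. Qed.

Lemma starB x y : star (x - y) = star x - star y.
Proof. by rewrite starD starN. Qed.

Lemma starZr r x : star (r%:C *: x) = r%:C *: star x.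
Proof. by rewrite starZ; congr (_ *: _); exact: conjc_real. Qed.

Lemma starX x k : star (x ^+ k) = star x ^+ k.
Proof. by elim: k => [|k IH]; rewrite ?star1// exprS starM IH -exprSr. Qed.

(** The C*-identity gives [cnorm y ^+ 2 <= cnorm (star y) * cnorm y]; one factor cancels, and [y]
    may be exchanged with [star y]. *)
Lemma cnorm_starE x : cnorm (star x) = cnorm x.
Proof.
suff le y : cnorm y <= cnorm (star y).
  by apply/le_anti; rewrite -{2}(starK x) !le.
have := cnorm_ge0 y; rewrite le_eqVlt => /predU1P[<-|y0]; first exact: cnorm_ge0.
by rewrite -(ler_pM2r y0) -expr2 -cnorm_star cnormM.
Qed.

Lemma cnorm1 : cnorm (1 : A) = 1.
Proof.
have n0 : cnorm (1 : A) != 0.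
  by apply/eqP => /cnorm_eq0/eqP; rewrite oner_eq0.
by apply: (mulfI n0); rewrite -expr2 -cnorm_star star1 !mulr1.
Qed.

Lemma cnormX_le x k : cnorm (x ^+ k) <= cnorm x ^+ k.
Proof.
elim: k => [|k IH]; first by rewrite cnorm1.
by rewrite !exprS (le_trans (cnormM _ _))// ler_wpM2l ?cnorm_ge0.
Qed.

(** On self-adjoint elements the C*-identity computes norms of squares exactly, hence also those of
    iterated squares. *)
Lemma cnormX2n x k : star x = x -> cnorm (x ^+ (2 ^ k)) = cnorm x ^+ (2 ^ k).
Proof.
move=> sx; elim: k => // k IH.
by rewrite expnSr !exprM -IH -cnorm_star starX sx expr2.
Qed.

Lemma cnorm_isometryM x y : star x * x = 1 -> cnorm (x * y) = cnorm y.
Proof.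
move=> xx; apply/eqP; rewrite -(@eqrXn2 _ 2) ?cnorm_ge0//.
by rewrite -!cnorm_star starM mulrA -(mulrA _ _ x) xx mulr1.
Qed.

Lemma cnorm_isometry x : star x * x = 1 -> cnorm x = 1.
Proof. by move=> xx; rewrite -(mulr1 x) cnorm_isometryM ?cnorm1. Qed.

Lemma cnorm_proj_le1 x : star x = x -> x * x = x -> cnorm x <= 1.
Proof.
move=> sx xx; have [->|x0] := eqVneq (cnorm x) 0; first exact: ler01.
rewrite (_ : cnorm x = 1)//; apply: (mulfI x0).
by rewrite -expr2 -cnorm_star sx xx mulr1.
Qed.

End CstarNorm.

(** * Square roots of positive elements by a contracting iteration *)

Section SquareRoot.
Variables (R : realType) (A : cstarAlgType R).
Implicit Types (x y z : A) (r e : R).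

(* The sequence converges to [1 - sqrt (1 - x)]. *)
Definition sqrt_iter x k : A := iter k (fun s => 2^-1%:C *: (x + s * s)) 0.

Lemma sqrt_iter_bound x k : cnorm x <= 1 -> cnorm (sqrt_iter x k) <= cnorm x.
Proof.
move=> x1; elim: k => [|k IH]; first by rewrite cnorm0 cnorm_ge0.
rewrite /= cnormZr ger0_norm ?invr_ge0//.
have := cnormD x (sqrt_iter x k * sqrt_iter x k).
have := cnormM (sqrt_iter x k) (sqrt_iter x k).
have := ler_pM (cnorm_ge0 _) (cnorm_ge0 _) IH IH.
have := ler_wpM2l (cnorm_ge0 x) x1; rewrite -/(sqrt_iter x k); lra.
Qed.

Lemma sqrt_iter_star x k : star x = x -> star (sqrt_iter x k) = sqrt_iter x k.
Proof.
move=> sx; elim: k => [|k IH]; first exact: star0.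
by rewrite /= starZr starD starM sx -/(sqrt_iter x k) IH.
Qed.

Lemma sqrt_iter_comm x y k : x * y = y * x ->
  sqrt_iter x k * y = y * sqrt_iter x k.
Proof.
move=> xy; elim: k => [|k IH]; first by rewrite mul0r mulr0.
rewrite /= -/(sqrt_iter x k) -scalerAl -scalerAr mulrDl mulrDr xy.
by rewrite -mulrA IH !mulrA IH.
Qed.

Lemma mulrB_split (x y : A) : x * x - y * y = (x - y) * x + y * (x - y).
Proof. by rewrite mulrBl mulrBr addrA subrK. Qed.

(** All iterates have norm at most [cnorm x], so half of a factored difference of squares contracts
    by the factor [cnorm x]. *)
Lemma sqrt_iter_step x k : cnorm x <= 1 ->
  cnorm (sqrt_iter x k.+1 - sqrt_iter x k) <= cnorm x ^+ k.
Proof.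
move=> x1; elim: k => [|k IH].
  by rewrite subr0 (le_trans (sqrt_iter_bound _ x1)).
have -> : sqrt_iter x k.+2 - sqrt_iter x k.+1 =
    2^-1%:C *: (sqrt_iter x k.+1 * sqrt_iter x k.+1
                - sqrt_iter x k * sqrt_iter x k).
  rewrite [sqrt_iter x k.+2]/= [X in _ - X = _]/= -/(sqrt_iter x k).
  by rewrite -/(sqrt_iter x k.+1) -scalerBr opprD addrACA subrr add0r.
rewrite cnormZr ger0_norm ?invr_ge0// mulrB_split.
set u := sqrt_iter x k.+1; set v := sqrt_iter x k.
have := cnormD ((u - v) * u) (v * (u - v)).
have := cnormM (u - v) u; have := cnormM v (u - v).
have := ler_wpM2l (cnorm_ge0 (u - v)) (sqrt_iter_bound k.+1 x1).
have := ler_wpM2l (cnorm_ge0 (u - v)) (sqrt_iter_bound k x1).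
have := ler_wpM2r (cnorm_ge0 x) IH.
rewrite -/u -/v [_ * cnorm (u - v)]mulrC exprSr; lra.
Qed.

Lemma sqrt_iter_dist x k j : cnorm x < 1 ->
  cnorm (sqrt_iter x (k + j) - sqrt_iter x k) <= cnorm x ^+ k / (1 - cnorm x).
Proof.
move=> x1.
(* The exact partial geometric sum is the form that passes through the induction on [j]. *)
suff: cnorm (sqrt_iter x (k + j) - sqrt_iter x k) <=
    cnorm x ^+ k * (1 - cnorm x ^+ j) / (1 - cnorm x).
  move=> /le_trans; apply.
  rewrite ler_pM2r ?invr_gt0 ?subr_gt0// ler_piMr ?exprn_ge0 ?cnorm_ge0//.
  by rewrite gerBl exprn_ge0 ?cnorm_ge0.
elim: j => [|j IH].
  by rewrite addn0 subrr cnorm0 expr0 subrr mulr0 mul0r.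
rewrite addnS (le_trans (cdist_tri (sqrt_iter x (k + j)) _ _))//.
apply: (le_trans (lerD (sqrt_iter_step _ (ltW x1)) IH)).
rewrite le_eqVlt; apply/orP; left; apply/eqP.
rewrite exprD exprSr; field; lra.
Qed.

Lemma sqrt1B_exists x : star x = x -> cnorm x < 1 ->
  exists p, [/\ star p = p, p * p = 1 - x &
    forall y, x * y = y * x -> p * y = y * p].
Proof.
move=> sx x1.
have geo e : 0 < e -> exists K, forall k, (K <= k)%N ->
    cnorm x ^+ k / (1 - cnorm x) < e.
  move=> e0.
  have c0 : cnorm x ^+ k / (1 - cnorm x) @[k --> \oo] --> (0 : R).
    rewrite -(mul0r (1 - cnorm x)^-1); apply: cvgMl.
    by apply: cvg_expr; rewrite ger0_norm ?cnorm_ge0.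
  have /cvgrPdist_lt/(_ _ e0)[K _ HK] := c0.
  exists K => k /HK /=; rewrite sub0r normrN; exact/le_lt_trans/ler_norm.
have [l cl] : exists l : A, cnorm (sqrt_iter x p - l) @[p --> \oo] --> (0 : R).
  apply: cnorm_complete => e e0.
  have [K HK] := geo _ (divr_gt0 e0 (ltr0n _ 2)).
  exists K => p q Kp Kq.
  rewrite (le_lt_trans (cdist_tri (sqrt_iter x K) _ _))//.
  rewrite (splitr e) cdistC [X in _ + X]cdistC -(subnKC Kp) -(subnKC Kq).
  rewrite [X in X + _]cdistC.
  by rewrite ltrD// (le_lt_trans (sqrt_iter_dist _ _ x1))// HK.
have el e : 0 < e -> exists K, forall k, (K <= k)%N ->
    cnorm (sqrt_iter x k - l) < e.
  move=> e0; have /cvgrPdist_lt/(_ _ e0)[K _ HK] := cl.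
  exists K => k /HK /=; rewrite sub0r normrN; exact/le_lt_trans/ler_norm.
have sl : star l = l.
  apply/subr0_eq/cnorm_eps_eq0 => e e0.
  have [K /(_ _ (leqnn K)) HK] := el _ (divr_gt0 e0 (ltr0n _ 2)).
  apply: (le_trans (cdist_tri (sqrt_iter x K) _ _)).
  rewrite -{1}(sqrt_iter_star K sx) -starB cnorm_starE cdistC; lra.
have l1 : cnorm l <= 1.
  apply: ler_add_eps => e e0; have [K /(_ _ (leqnn K)) HK] := el _ e0.
  have := sqrt_iter_bound K (ltW x1).
  have := cnormB (sqrt_iter x K) (sqrt_iter x K - l); rewrite subKr; lra.
(* The limit is a fixed point, [2 l = x + l * l], which says that [1 - l] squares to [1 - x]. *)
have ql : l = 2^-1%:C *: (x + l * l).
  apply/subr0_eq/cnorm_eps_eq0 => e e0.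
  have [K HK] := el _ (divr_gt0 e0 (ltr0n _ 2)).
  have := HK _ (leqnn K); have := HK _ (leqnSn K).
  set u := sqrt_iter x K; set v := sqrt_iter x K.+1 => vl ul.
  apply: (le_trans (cdist_tri v _ _)).
  rewrite {2}/v /= -/(sqrt_iter x K) -/u -scalerBr opprD addrACA subrr add0r.
  rewrite cnormZr ger0_norm ?invr_ge0// mulrB_split.
  have := cnormD ((u - l) * u) (l * (u - l)).
  have := cnormM (u - l) u; have := cnormM l (u - l).
  have u1 : cnorm u <= 1 by rewrite (le_trans (sqrt_iter_bound _ (ltW x1)))// ltW.
  have := ler_wpM2l (cnorm_ge0 (u - l)) u1.
  have := ler_wpM2r (cnorm_ge0 (u - l)) l1.
  rewrite (cdistC l v); lra.
exists (1 - l); split; first by rewrite starB star1 sl.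
  have ll : l + l = x + l * l.
    by rewrite {1 2}ql -scalerDl -rmorphD/= -splitr1 scale1r.
  have -> : x = l + l - l * l by rewrite ll addrK.
  by rewrite mulrBl !mulrBr !mul1r mulr1 !opprD !opprK !addrA.
move=> y xy; rewrite mulrBl mulrBr mul1r mulr1; congr (_ - _).
apply/subr0_eq/cnorm_eps_eq0 => e e0.
have y1 : 0 < cnorm y + 1 by rewrite ltr_pwDr ?cnorm_ge0.
have [K /(_ _ (leqnn K))] := el _ (divr_gt0 (divr_gt0 e0 (ltr0n _ 2)) y1).
set u := sqrt_iter x K; rewrite ltr_pdivlMr// => ul.
have -> : l * y - y * l = y * (u - l) - (u - l) * y.
  by rewrite mulrBl mulrBr -(sqrt_iter_comm K xy) opprB [RHS]addrC addrA subrK.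
have := cnormB (y * (u - l)) ((u - l) * y).
have := cnormM y (u - l); have := cnormM (u - l) y.
have := cnorm_ge0 (u - l); rewrite mulrDr mulr1 [cnorm y * _]mulrC in ul *; lra.
Qed.

Lemma sqrt_exists x r : star x = x -> cnorm x < r ->
  exists p, [/\ star p = p, p * p = r%:C%:A - x &
    forall y, x * y = y * x -> p * y = y * p].
Proof.
move=> sx xr; have r0 : 0 < r := le_lt_trans (cnorm_ge0 x) xr.
have [||p [sp pp pc]] := @sqrt1B_exists (r^-1%:C *: x).
- by rewrite starZr sx.
- by rewrite cnormZr ger0_norm ?invr_ge0 ?ltW// mulrC ltr_pdivrMr// mul1r.
exists ((Num.sqrt r)%:C *: p); split; first by rewrite starZr sp.
  rewrite -scalerAl -scalerAr scalerA -rmorphM/= -expr2 sqr_sqrtr ?ltW// pp.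
  by rewrite scalerBr scalerA -rmorphM/= divff ?gt_eqF// scale1r.
move=> y xy; rewrite -scalerAl -scalerAr pc//.
by rewrite -scalerAl -scalerAr xy.
Qed.

(* [x + i y] is [r] times a unitary, and [x] is its real part. *)
Lemma cnorm_sum_squares x y r : 0 <= r -> star x = x -> star y = y ->
  x * y = y * x -> x * x + y * y = (r ^+ 2)%:C%:A -> cnorm x <= r.
Proof.
move=> r0 sx sy xy sq; pose u := x + 'i%R *: y.
have su : star u = x - 'i%R *: y.
  by rewrite starD starZ sx sy conjCi scaleNr.
have ur : cnorm u = r.
  apply/eqP; rewrite -(@eqrXn2 _ 2) ?cnorm_ge0// -cnorm_star su.
  have ii : 'i%R * 'i%R = -1 :> R[i] by rewrite -expr2 sqrCi.
  rewrite mulrDr !mulrBl -!scalerAr -!scalerAl scalerA xy ii.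
  by rewrite scaleN1r opprK addrA subrK sq cnormZr cnorm1 mulr1 ger0_norm ?exprn_ge0.
have -> : x = 2^-1%:C *: (u + star u).
  by rewrite su addrACA subrr addr0 scalerDr -scalerDl -rmorphD/= -splitr1 scale1r.
rewrite cnormZr ger0_norm ?invr_ge0//.
have := cnormD u (star u); rewrite cnorm_starE ur; lra.
Qed.

End SquareRoot.

(** * Contractivity of *-homomorphisms *)

Section StarMorphism.
Variables (R : realType) (A B : cstarAlgType R) (phi : {lrmorphism A -> B}).
Hypothesis phi_star : forall x, phi (star x) = star (phi x).

(** By the C*-identity it suffices to bound a self-adjoint [b]. For [r > cnorm b] a root [p] of
    [r ^+ 2 - b * b] commutes with [b], and the relation [b * b + p * p = r ^+ 2] survives [phi],
    which forces [cnorm (phi b) <= r]. *)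
Lemma star_morphism_contractive x : cnorm (phi x) <= cnorm x.
Proof.
rewrite -(@ler_pXn2r _ 2) ?nnegrE ?cnorm_ge0// -!cnorm_star -phi_star -rmorphM.
have: star (star x * x) = star x * x by rewrite starM starK.
move: (star x * x) => {x}b sb.
apply: ler_add_eps => e e0.
have br : cnorm b < cnorm b + e by rewrite ltrDl.
have r0 : 0 < cnorm b + e := le_lt_trans (cnorm_ge0 b) br.
have [||p [sp pp pc]] := @sqrt_exists _ _ (b * b) ((cnorm b + e) ^+ 2).
- by rewrite starM sb.
- rewrite (le_lt_trans (cnormM _ _))// -expr2.
  by rewrite ltr_pXn2r ?nnegrE ?cnorm_ge0// ltW.
apply: (@cnorm_sum_squares _ _ (phi b) (phi p)); first exact: ltW.
- by rewrite -phi_star sb.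
- by rewrite -phi_star sp.
- by rewrite -!rmorphM -(pc b)// mulrA.
- rewrite -!rmorphM -rmorphD pp addrC subrK.
  by rewrite /= linearZ_LR rmorph1.
Qed.

End StarMorphism.

(** * Orthogonality of the ranges of the generators *)

Section Orthogonality.
Variables (R : realType) (n : nat) (A : cstarAlgType R) (S : 'I_n -> A).
Hypothesis cS : cuntz_family S.

(* The [star (S i) * S j] with [i != j] are elements whose squares add up to
   zero; as the sums [m + b] and [1 - b] below have norm at most [m] and [1],
   both [e + b] and [m e - b] are squares for every [e > 0]. *)
Lemma cuntz_orthogonal i j : star (S i) * S j = (i == j)%:R.
Proof.
case: cS => iso sum1.
have [->|ij] := eqVneq i j; first exact: iso.
pose a k := star (S k) * S j.
have aa k : star (a k) * a k = star (S j) * (S k * star (S k)) * S j.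
  by rewrite /a starM starK !mulrA.
have suma : \sum_(k < n) star (a k) * a k = 1.
  under eq_bigr do rewrite aa.
  by rewrite -mulr_suml -mulr_sumr sum1 mulr1 iso.
have bound k : cnorm (1 - star (a k) * a k) <= 1.
  have -> : 1 - star (a k) * a k = star (S j) * (1 - S k * star (S k)) * S j.
    by rewrite mulrBr mulrBl mulr1 iso -aa.
  rewrite (le_trans (cnormM _ _))// (cnorm_isometry (iso j)) mulr1.
  rewrite (le_trans (cnormM _ _))// cnorm_starE (cnorm_isometry (iso j)) mul1r.
  apply: cnorm_proj_le1; first by rewrite starB star1 starM starK.
  rewrite mulrBl mul1r mulrBr mulr1 -mulrA (mulrA (star _)) iso mul1r subrr subr0.
  by [].
pose b := star (a i) * a i; have sb : star b = b by rewrite starM starK.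
pose P := [pred k | (k != j) && (k != i)].
pose m : R := #|P|%:R; have m0 : 0 <= m := ler0n _ _.
have mb : cnorm (m%:C%:A + b) <= m.
  (* The term [k = j] of [suma] is already 1, so the others add up to zero and [b] is minus the sum
     over [P]. *)
  have -> : m%:C%:A + b = \sum_(k | P k) (1 - star (a k) * a k).
    rewrite big_split /= sumr_const rmorph_nat scaler_nat; congr (_ + _).
    move: suma; rewrite (bigD1 j)//= (bigD1 i)//= -/b {1 2}/a iso star1 mulr1.
    move=> /(congr1 (fun z => z - 1)); rewrite subrr addrAC subrr add0r sumrN.
    by move/eqP; rewrite addr_eq0 => /eqP.
  rewrite big_mkcond/= (le_trans (cnorm_sum _ _))//.
  rewrite /m -sumr_const (big_mkcond P)/=; apply: ler_sum => k _.
  by case: ifP => _; rewrite ?cnorm0 ?bound.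
suff b0 : b = 0.
  by apply: cnorm_eq0; apply/eqP; rewrite -sqrf_eq0 -cnorm_star -/(a i) -/b b0 cnorm0.
apply: cnorm_eps_eq0 => e e0.
have m2 : 0 < m + 3 by lra.
(* The final estimate is [cnorm b <= 3 d], which this choice keeps below [e]. *)
pose d := e / (m + 3); have d0 : 0 < d by rewrite divr_gt0.
have d2 : 0 <= 2 * d by lra.
have cb r : (r%:C%:A + b) * b = b * (r%:C%:A + b).
  by rewrite mulrDl mulrDr -scalerAl -scalerAr mul1r mulr1.
have [||p [sp pp pc]] := @sqrt_exists _ _ (m%:C%:A + b) (m + d).
- by rewrite starD starZr star1 sb.
- by rewrite (le_lt_trans mb)// ltrDl.
have [||t [st tt tc]] := @sqrt_exists _ _ (1 - b) (1 + d).
- by rewrite starB star1 sb.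
- by rewrite (le_lt_trans (bound i))// ltrDl.
have pb : p * b = b * p by apply: pc.
have ttE : t * t = d%:C%:A + b.
  by rewrite tt rmorphD/= scalerDl scale1r opprB addrC addrA addrNK addrC.
have tp : t * p = p * t by apply: tc; rewrite mulrBl mulrBr mulr1 mul1r pb.
(* Here [t * t = d + b] and [p * p = d - b], so [b] cancels in the sum. *)
have tq : t * t + p * p = (Num.sqrt (2 * d) ^+ 2)%:C%:A.
  rewrite sqr_sqrtr// ttE pp.
  rewrite opprD (addrA (m + d)%:C%:A) (addrC d%:C%:A) [LHS]addrC addrA subrK.
  rewrite rmorphD/= scalerDl.
  rewrite (addrC m%:C%:A) addrK.
  by rewrite -scalerDl -rmorphD/= mulrDl mul1r.
have t2 := cnorm_sum_squares (sqrtr_ge0 _) st sp tp tq.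
have : cnorm (t * t) <= 2 * d.
  rewrite (le_trans (cnormM _ _))// -expr2.
  by rewrite -(@sqr_sqrtr _ (2 * d))// ler_pXn2r ?nnegrE ?cnorm_ge0 ?sqrtr_ge0.
have bE : b = t * t - d%:C%:A by rewrite ttE addrAC subrr add0r.
have -> : e = d * (m + 3) by rewrite divfK ?gt_eqF.
have := mulr_ge0 m0 (ltW d0); have := cnormB (t * t) d%:C%:A.
rewrite -bE cnormZr cnorm1 (ger0_norm (ltW d0)); lra.
Qed.

End Orthogonality.

(** * Homogeneous elements of a Cuntz family *)

Section CuntzFamily.
Variables (R : realType) (n : nat) (A : cstarAlgType R) (S : 'I_n -> A).
Hypothesis cS : cuntz_family S.
Implicit Types (x y z u v g h : A) (a c : R[i]) (e : R).

Let iso i : star (S i) * S i = 1 := cS.1 i.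
Let orth i j : star (S i) * S j = (i == j)%:R := cuntz_orthogonal cS i j.

Lemma cuntz_expandl y : y = \sum_(i < n) S i * (star (S i) * y).
Proof. by under eq_bigr do rewrite mulrA; rewrite -mulr_suml cS.2 mul1r. Qed.

Lemma cuntz_expandr y : y = \sum_(i < n) y * S i * star (S i).
Proof. by under eq_bigr do rewrite -mulrA; rewrite -mulr_sumr cS.2 mulr1. Qed.

Lemma cnorm_mulS_le y i : cnorm (y * S i) <= cnorm y.
Proof. by rewrite (le_trans (cnormM _ _))// (cnorm_isometry (iso i)) mulr1. Qed.

Lemma cnorm_starS_mul_le y i : cnorm (star (S i) * y) <= cnorm y.
Proof.
by rewrite (le_trans (cnormM _ _))// cnorm_starE (cnorm_isometry (iso i)) mul1r.
Qed.

Fixpoint row_homogeneous q y : Prop :=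
  if q is q'.+1 then forall j, row_homogeneous q' (y * S j)
  else exists c : R[i], y = c%:A.

(* [homogeneous p q y] says that [y] is a linear combination of the
   [S_mu S_nu^*] with [|mu| = p] and [|nu| = q], in the form: all the
   [S_mu^* y S_nu] are scalars. *)
Fixpoint homogeneous p q y : Prop :=
  if p is p'.+1 then forall i, homogeneous p' q (star (S i) * y)
  else row_homogeneous q y.

(** The recursion exhausts the left letters before the right ones; by associativity a right letter
    may also be taken first. *)
Lemma homogeneousSr p q y :
  homogeneous p q.+1 y <-> forall j, homogeneous p q (y * S j).
Proof.
elim: p y => [|p IH] y //=; split=> hy.
  by move=> j i; rewrite mulrA; exact: (IH _).1.
by move=> i; apply: (IH _).2 => j; rewrite -mulrA; exact: hy.
Qed.

Lemma homogeneous0 p q : homogeneous p q 0.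
Proof.
elim: p => [|p IH] /=; last by move=> i; rewrite mulr0.
by elim: q => [|q IH] /=; [exists 0; rewrite scale0r | move=> j; rewrite mul0r].
Qed.

Lemma homogeneousD p q y z :
  homogeneous p q y -> homogeneous p q z -> homogeneous p q (y + z).
Proof.
elim: p y z => [|p IH] y z /=; last by move=> hy hz i; rewrite mulrDr; apply: IH.
elim: q y z => [|q IH] y z /=; last by move=> hy hz i; rewrite mulrDl; apply: IH.
by move=> [c ->] [d ->]; exists (c + d); rewrite scalerDl.
Qed.

Lemma homogeneousZ p q a y : homogeneous p q y -> homogeneous p q (a *: y).
Proof.
elim: p y => [|p IH] y /=; last by move=> hy i; rewrite -scalerAr; apply: IH.
elim: q y => [|q IH] y /=; last by move=> hy i; rewrite -scalerAl; apply: IH.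
by move=> [c ->]; exists (a * c); rewrite scalerA.
Qed.

Lemma homogeneous_sum p q (I : Type) (s : seq I) (F : I -> A) :
  (forall i, homogeneous p q (F i)) -> homogeneous p q (\sum_(i <- s) F i).
Proof.
by move=> hF; elim/big_rec: _ => [|i y _]; [exact: homogeneous0|exact: homogeneousD].
Qed.

(** The [q] inner letters are removed by inserting [1 = \sum_i S i * star (S i)] between the
    factors. *)
Lemma homogeneousM p q r y z :
  homogeneous p q y -> homogeneous q r z -> homogeneous p r (y * z).
Proof.
elim: p y => [|p IH] y /=; last by move=> hy hz i; rewrite mulrA; apply: IH.
elim: r z => [|r IH] z; last first.
  by move=> hy /homogeneousSr hz /= j; rewrite -mulrA; apply: IH.
elim: q y z => [|q IH] y z /=.
  by move=> [c ->] [d ->]; exists (c * d); rewrite -scalerAl mul1r scalerA.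
move=> hy hz; rewrite [z]cuntz_expandl mulr_sumr.
by apply: (@homogeneous_sum 0 0) => i; rewrite mulrA; apply: IH.
Qed.

Lemma homogeneous_star p q y : homogeneous p q y -> homogeneous q p (star y).
Proof.
elim: p y => [|p IH] y; last first.
  by move=> hy; apply/homogeneousSr => j; rewrite -[S j]starK -starM; apply: IH.
elim: q y => [|q IH] y /=; last by move=> hy i; rewrite -starM; apply: IH.
by move=> [c ->]; exists (c^*)%R; rewrite starZ star1.
Qed.

(** In words, [S_mu S_nu^*] is the sum over [i] of [S_mu S_i S_i^* S_nu^*]; orthogonality yields the
    new coefficients. *)
Lemma homogeneousSS p q y : homogeneous p q y -> homogeneous p.+1 q.+1 y.
Proof.
elim: p y => [|p IH] y; last by move=> hy i; exact: IH.
elim: q y => [|q IH] y; last first.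
  by move=> hy; apply/homogeneousSr => j; exact: IH.
move=> [c ->] i j; rewrite -scalerAr mulr1 -scalerAl orth.
by case: eqP => _; [exists c | exists 0; rewrite scaler0 scale0r].
Qed.

Lemma homogeneous_widen p q k y :
  homogeneous p q y -> homogeneous (p + k) (q + k) y.
Proof.
by move=> hy; elim: k => [|k IH]; rewrite ?addn0// !addnS; exact: homogeneousSS.
Qed.

Lemma homogeneous_scalar k c : homogeneous k k c%:A.
Proof. by apply: (@homogeneous_widen 0 0 k); exists c. Qed.

Lemma homogeneousX k m y : homogeneous k k y -> homogeneous k k (y ^+ m).
Proof.
move=> hy; elim: m => [|m IH]; last by rewrite exprS; exact: homogeneousM IH.
by rewrite expr0 -[1]scale1r; exact: homogeneous_scalar.
Qed.

Lemma homogeneousS i : homogeneous 1 0 (S i).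
Proof.
move=> j /=; rewrite orth.
by case: eqP => _; [exists 1; rewrite scale1r | exists 0; rewrite scale0r].
Qed.

Lemma star_mul_rows y :
  star y * y = \sum_(i < n) star (star (S i) * y) * (star (S i) * y).
Proof.
rewrite {2}[y]cuntz_expandl mulr_sumr.
by apply: eq_bigr => i _; rewrite starM starK mulrA.
Qed.

(** As [S_mu^* S_nu] is a Kronecker delta for words of equal length, [star y * y] is the scalar sum
    of the squared moduli of the coefficients; the C*-identity recognises it as the squared norm. *)
Lemma homogeneous_column_norm p y : homogeneous p 0 y ->
  star y * y = (cnorm y ^+ 2)%:C%:A.
Proof.
elim: p y => [|p IH] y /= hy.
  have [c ->] := hy; rewrite starZ star1 -scalerAl mul1r scalerA.
  rewrite cnormZE cnorm1 mulr1; congr (_ *: _).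
  by rewrite mulrC -normCK rmorphXn.
have yy : star y * y = (\sum_(i < n) cnorm (star (S i) * y) ^+ 2)%:C%:A.
  rewrite star_mul_rows rmorph_sum scaler_suml.
  by apply: eq_bigr => i _; rewrite IH.
rewrite yy -cnorm_star yy cnormZr cnorm1 mulr1 ger0_norm//.
by apply: sumr_ge0 => i _; rewrite exprn_ge0 ?cnorm_ge0.
Qed.

(** * The trace and its null elements *)

Fixpoint tr k y : R :=
  if k is k'.+1 then \sum_(i < n) tr k' (y * S i) else cnorm y ^+ 2.

Lemma tr_ge0 k y : 0 <= tr k y.
Proof.
elim: k y => [|k IH] y /=; first by rewrite exprn_ge0 ?cnorm_ge0.
by apply: sumr_ge0.
Qed.

Lemma trM_le k y z : tr k (y * z) <= cnorm y ^+ 2 * tr k z.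
Proof.
elim: k z => [|k IH] z /=.
  by rewrite -exprMn ler_pXn2r ?nnegrE ?mulr_ge0 ?cnorm_ge0// cnormM.
by rewrite mulr_sumr; apply: ler_sum => i _; rewrite -mulrA IH.
Qed.

Lemma trD_le k y z : tr k (y + z) <= 2 * (tr k y + tr k z).
Proof.
elim: k y z => [|k IH] y z /=.
  have := cnormD y z; rewrite -(@ler_pXn2r _ 2) ?nnegrE ?addr_ge0 ?cnorm_ge0//.
  have := sqr_ge0 (cnorm y - cnorm z); lra.
rewrite -big_split /= mulr_sumr.
by apply: ler_sum => i _; rewrite mulrDl IH.
Qed.

Lemma sum_const_bound (k : nat) (F : 'I_n -> R) (b : R) :
  (forall i, F i <= b * n%:R ^+ k) -> \sum_(i < n) F i <= b * n%:R ^+ k.+1.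
Proof.
move=> Fb; apply: (@le_trans _ _ (\sum_(i < n) b * n%:R ^+ k)).
  by apply: ler_sum => i _.
by rewrite sumr_const card_ord -[leLHS]mulr_natr exprSr mulrA.
Qed.

(** Each of the [n ^ k] words costs a difference of squared norms, and right multiplication by
    isometries increases none of the norms involved. *)
Lemma tr_le_dist k x y :
  tr k x <= tr k y + cnorm (x - y) * (cnorm x + cnorm y) * n%:R ^+ k.
Proof.
elim: k x y => [|k IH] x y /=.
  have := cnormD (x - y) y; rewrite subrK => xy.
  have := ler_wpM2r (addr_ge0 (cnorm_ge0 x) (cnorm_ge0 y)) xy; lra.
rewrite -lerBlDl -sumrB; apply: sum_const_bound => // i.
rewrite lerBlDl (le_trans (IH _ (y * S i)))// lerD2l ler_wpM2r ?exprn_ge0//.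
by rewrite -mulrBl ler_pM ?addr_ge0 ?cnorm_ge0 ?lerD ?cnorm_mulS_le.
Qed.

Lemma tr_le k x : tr k x <= cnorm x ^+ 2 * n%:R ^+ k.
Proof.
elim: k x => [|k IH] x /=; first by rewrite mulr1.
apply: sum_const_bound => // i; rewrite (le_trans (IH _))// ler_wpM2r ?exprn_ge0//.
by rewrite ler_pXn2r ?nnegrE ?cnorm_ge0// cnorm_mulS_le.
Qed.

(** By the C*-identity each summand depends only on [star x * x]. For [x] normal this allows
    replacing [x] by [star x]. *)
Lemma tr_eq k x y : star x * x = star y * y -> tr k x = tr k y.
Proof.
elim: k x y => [|k IH] x y xy /=; first by rewrite -!cnorm_star xy.
by apply: eq_bigr => i _; apply: IH; rewrite !starM mulrA -(mulrA _ _ x) xy !mulrA.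
Qed.

Lemma tr_scale_isometry k a v : star v * v = 1 ->
  tr k (a *: v) = Normc.normc a ^+ 2 * n%:R ^+ k.
Proof.
elim: k v => [|k IH] v vv /=; first by rewrite cnormZE cnorm_isometry// !mulr1.
have vS i : star (v * S i) * (v * S i) = 1.
  by rewrite starM mulrA -(mulrA _ _ v) vv mulr1.
under eq_bigr => i _ do rewrite -scalerAl IH//.
by rewrite sumr_const card_ord -[LHS]mulr_natr (exprSr n%:R) mulrA.
Qed.

(** Squared norms of columns are sums over coefficients, hence additive in the first left letter;
    larger [q] only adds an outer sum over right words. *)
Lemma tr_rows p q y : homogeneous p.+1 q y ->
  \sum_(i < n) tr q (star (S i) * y) = tr q y.
Proof.
elim: q y => [|q IH] y hy /=; last first.
  rewrite exchange_big /=; apply: eq_bigr => j _.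
  have /homogeneousSr/(_ j)/IH <- := hy.
  by under eq_bigr do rewrite -mulrA.
rewrite /= -(cnorm_star y) star_mul_rows.
under [in RHS]eq_bigr => i _ do rewrite (homogeneous_column_norm (hy i)).
rewrite -scaler_suml -rmorph_sum cnormZr cnorm1 mulr1 ger0_norm//.
by apply: sumr_ge0 => i _; rewrite exprn_ge0 ?cnorm_ge0.
Qed.

Lemma tr_star p q y : homogeneous p q y -> tr p (star y) = tr q y.
Proof.
elim: p y => [|p IH] y hy; last first.
  rewrite -(tr_rows hy) /=; apply: eq_bigr => i _.
  by rewrite -IH// starM starK.
elim: q y hy => [|q IH] y hy; first by rewrite /= cnorm_starE.
rewrite -(tr_rows (homogeneous_star hy)); apply: eq_bigr => j _.
by rewrite -starM IH.
Qed.

(* The elements of trace zero, in a form which makes sense outside the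
   fixed-point algebra and visibly gives a left ideal. *)
Definition null u := forall e, 0 < e ->
  exists K, forall k, (K <= k)%N -> tr k u <= e * n%:R ^+ k.

Lemma null_dominated u v (b : R) j : 0 < b ->
  (forall k, (j <= k)%N -> tr k u <= b * tr k v) -> null v -> null u.
Proof.
move=> b0 uv nv e e0; have [K HK] := nv _ (divr_gt0 e0 b0).
exists (maxn j K) => k; rewrite geq_max => /andP[jk Kk].
rewrite (le_trans (uv _ jk))// mulrC -ler_pdivlMr// mulrAC.
exact: HK.
Qed.

Lemma null0 : null 0.
Proof.
move=> e e0; exists 0%N => k _; rewrite (le_trans (tr_le _ _))//.
by rewrite cnorm0 expr0n/= mul0r mulr_ge0 ?exprn_ge0 ?(ltW e0).
Qed.

Lemma nullD u v : null u -> null v -> null (u + v).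
Proof.
move=> nu nv e e0; have e4 : 0 < e / 4 by rewrite divr_gt0.
have [K HK] := nu _ e4; have [L HL] := nv _ e4.
exists (maxn K L) => k; rewrite geq_max => /andP[Kk Lk].
have := trD_le k u v; have := HK _ Kk; have := HL _ Lk.
lra.
Qed.

Lemma nullMl y u : null u -> null (y * u).
Proof.
apply: (@null_dominated _ _ (cnorm y ^+ 2 + 1) 0) => [|k _].
  by rewrite ltr_pwDr ?exprn_ge0 ?cnorm_ge0.
by rewrite (le_trans (trM_le _ _ _))// ler_wpM2r ?tr_ge0// lerDl.
Qed.

Lemma null_sum (F : 'I_n -> A) : (forall i, null (F i)) ->
  null (\sum_(i < n) F i).
Proof.
by move=> nF; elim/big_rec: _ => [|i u _]; [exact: null0|exact: nullD].
Qed.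

(** The trace of [u * S i] at level [k] is one summand of that of [u] at level [k.+1]; the extra
    factor [n] is absorbed into [e]. *)
Lemma null_mulS u i : null u -> null (u * S i).
Proof.
move=> nu e e0; have n1 : 0 < n%:R :> R by rewrite ltr0n (leq_ltn_trans _ (ltn_ord i)).
have [K HK] := nu _ (divr_gt0 e0 n1).
exists K => k Kk; apply: (@le_trans _ _ (tr k.+1 u)).
  by rewrite /= (bigD1 i)//= lerDl sumr_ge0// => j _; exact: tr_ge0.
rewrite (le_trans (HK _ (leqW Kk)))// exprS mulrA divfK ?gt_eqF//.
Qed.

(** Only words beginning with [i] contribute, and [star (S i)] cancels that letter. *)
Lemma tr_mul_starS k u i : tr k.+1 (u * star (S i)) = tr k u.
Proof.
rewrite /= (bigD1 i)//= -mulrA iso mulr1 big1 ?addr0// => j ji.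
rewrite -mulrA orth eq_sym (negPf ji) mulr0; apply/le_anti.
by rewrite tr_ge0 andbT (le_trans (tr_le _ _))// cnorm0 expr0n/= mul0r.
Qed.

Lemma null_mul_starS u i : null u -> null (u * star (S i)).
Proof.
move=> nu e e0; have n1 : 1 <= n%:R :> R by rewrite ler1n (leq_ltn_trans _ (ltn_ord i)).
have [K HK] := nu _ e0; exists K.+1 => -[//|k] Kk.
rewrite tr_mul_starS (le_trans (HK _ Kk))// ler_wpM2l ?(ltW e0)//.
by rewrite ler_weXn2l.
Qed.

Lemma null_mul_homogeneous p q u g :
  null u -> homogeneous p q g -> null (u * g).
Proof.
elim: p u g => [|p IH] u g nu hg; last first.
  rewrite [g]cuntz_expandl mulr_sumr; apply: null_sum => i.
  by rewrite mulrA; apply: IH; [exact: null_mulS|exact: hg].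
elim: q g hg => [|q IH] g; last first.
  move=> hg; rewrite [g]cuntz_expandr mulr_sumr; apply: null_sum => i.
  by rewrite mulrA; apply/null_mul_starS/IH/hg.
by move=> [c ->]; rewrite -scalerAr mulr1 -[u]mul1r scalerAl; apply: nullMl.
Qed.

(** At level [K] the scalar has trace exactly [|c| ^+ 2 * n ^ K], that of [z] is at most
    [cnorm z ^+ 2 * n ^ K], and the difference is negligible. The constant comes from [trD_le]. *)
Lemma scalar_norm_null c z : (0 < n)%N -> null (c%:A - z) ->
  cnorm (c%:A : A) <= 2 * cnorm z.
Proof.
rewrite -(ltr0n R) => n0 ncz.
suff: cnorm (c%:A : A) ^+ 2 <= 2 * cnorm z ^+ 2.
  move=> cz; rewrite -(@ler_pXn2r _ 2) ?nnegrE ?mulr_ge0 ?cnorm_ge0//.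
  have := sqr_ge0 (cnorm z); lra.
apply: ler_add_eps => e e0.
have [K /(_ _ (leqnn K)) HK] := ncz _ (divr_gt0 e0 (ltr0n _ 2)).
have nK : 0 < n%:R ^+ K :> R by rewrite exprn_gt0.
rewrite -(ler_pM2r nK) cnormZE cnorm1 mulr1 -(@tr_scale_isometry _ _ 1) ?star1 ?mulr1//.
have := trD_le K (c%:A - z) z; rewrite subrK.
have := tr_le K z; lra.
Qed.

(** The scalar case is applied to each coefficient, and each of the [p + q] letters costs a factor
    [n]. What matters is that the constant depends on the bidegree alone. *)
Lemma homogeneous_norm_null p q g z : (0 < n)%N -> homogeneous p q g ->
  null (g - z) -> cnorm g <= 2 * n%:R ^+ (p + q) * cnorm z.
Proof.
move=> n0; elim: p g z => [|p IH] g z hg nz.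
  elim: q g z hg nz => [|q IH] g z hg nz.
    by have [c gc] := hg; rewrite mulr1 gc scalar_norm_null -?gc.
  rewrite [g]cuntz_expandr (le_trans (cnorm_sum _ _))// mulrAC.
  apply: sum_const_bound => i; rewrite mulrAC.
  rewrite (le_trans (cnormM _ _))// cnorm_starE (cnorm_isometry (iso i)) mulr1.
  have := IH _ (z * S i) (hg i); rewrite -mulrBl.
  move=> /(_ (null_mulS _ nz))/le_trans; apply.
  by rewrite ler_wpM2l ?mulr_ge0 ?exprn_ge0// cnorm_mulS_le.
rewrite [g]cuntz_expandl (le_trans (cnorm_sum _ _))// mulrAC.
apply: sum_const_bound => i; rewrite mulrAC.
rewrite cnorm_isometryM//.
have := IH _ (star (S i) * z) (hg i); rewrite -mulrBr.
move=> /(_ (nullMl _ nz))/le_trans; apply.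
by rewrite ler_wpM2l ?mulr_ge0 ?exprn_ge0// cnorm_starS_mul_le.
Qed.

(** The difference telescopes into terms ending in [h], which lie in the left ideal, and terms
    multiplied on the right by the homogeneous [g]. *)
Lemma null_subX k g h m : homogeneous k k g -> null h ->
  null ((g - h) ^+ m - g ^+ m).
Proof.
move=> hg nh; elim: m => [|m IH]; first by rewrite subrr; exact: null0.
have -> : (g - h) ^+ m.+1 - g ^+ m.+1 =
    ((g - h) ^+ m - g ^+ m) * g + - (g - h) ^+ m * h.
  by rewrite !exprSr mulrBl mulrBr mulNr addrAC.
by apply: nullD; [exact: null_mul_homogeneous IH hg|exact: nullMl].
Qed.

(* The trace has no kernel on the fixed-point algebra: modulo null elements,
   [g ^+ m] is the element [(g - h) ^+ m] of norm at most [d ^+ m], and for the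
   homogeneous [g ^+ m] this bounds the norm up to a factor independent of
   [m]. *)
Lemma null_eq0 h : (0 < n)%N -> null h ->
  (forall e, 0 < e -> exists k g,
     [/\ homogeneous k k g, star g = g & cnorm (g - h) <= e]) -> h = 0.
Proof.
move=> n0 nh appr; apply: cnorm_eps_eq0 => e e0.
have d0 := divr_gt0 e0 (ltr0n _ 2); set d := e / 2 in d0.
have [k [g [hg sg gh]]] := appr _ d0.
suff gd : cnorm g <= d.
  have := cnormB g (g - h); rewrite subKr /d in gh gd *; lra.
rewrite leNgt; apply/negP => dg.
have g0 : 0 < cnorm g := lt_trans d0 dg.
pose C : R := 2 * n%:R ^+ (k + k).
have C0 : 0 < C by rewrite mulr_gt0// exprn_gt0// ltr0n.
(* At exponents [2 ^ j] the norm of the power of [g] is exact, so the fixed constant [C] would have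
   to beat a geometric sequence of ratio below 1. *)
have le j : 1 <= C * (d / cnorm g) ^+ (2 ^ j).
  rewrite expr_div_n mulrA ler_pdivlMr ?exprn_gt0// mul1r -cnormX2n//.
  rewrite (le_trans (@homogeneous_norm_null k k _ ((g - h) ^+ (2 ^ j)) n0 _ _))//.
  - exact: homogeneousX.
  - by rewrite -opprB -mulN1r; apply/nullMl/null_subX/nh/hg.
  - rewrite ler_wpM2l ?(ltW C0)// (le_trans (cnormX_le _ _))//.
    by rewrite ler_pXn2r ?expn_gt0 ?nnegrE ?cnorm_ge0 ?(ltW d0).
have : C * (d / cnorm g) ^+ m @[m --> \oo] --> (0 : R).
  rewrite -(mulr0 C); apply: cvgMr; apply: cvg_expr.
  by rewrite ger0_norm ?divr_ge0 ?ltW// ltr_pdivrMr// mul1r.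
move=> /cvgrPdist_lt/(_ _ ltr01)[K _ HK].
have /HK : (K <= 2 ^ K)%N by rewrite ltnW// ltn_expl.
by rewrite /= sub0r normrN ger0_norm ?(le_trans ler01)// ltNge le.
Qed.

(* Writing [tau] for the trace, [y] homogeneous of degree one satisfies
   [n * tau (y y^* ) = tau (y^* y)]; for [x] normal this forces
   [tau (x^* x) = 0]. *)
Lemma normal_degree_one_null x : (2 <= n)%N -> normal_elt x ->
  (forall e, 0 < e -> exists k y, homogeneous k.+1 k y /\ cnorm (x - y) <= e) ->
  null x.
Proof.
move=> n2 nx appr e e0.
set M := cnorm x; have M0 : 0 <= M := cnorm_ge0 x.
have M1 : 0 < 8 * (2 * M + 1) by lra.
(* The bound 1 keeps [cnorm x + cnorm y] below [2 * M + 1]; the other bound yields [8 * D <= e]. *)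
pose eta := Num.min 1 (e / (8 * (2 * M + 1))).
have eta0 : 0 < eta by rewrite lt_min ltr01 divr_gt0.
have [k [y [hy xy]]] := appr _ eta0.
pose D : R := eta * (2 * M + 1).
have D8 : 8 * D <= e.
  have : eta <= e / (8 * (2 * M + 1)) by rewrite ge_min lexx orbT.
  by rewrite ler_pdivlMr// /D; lra.
have xyD : cnorm (x - y) * (cnorm x + cnorm y) <= D.
  rewrite ler_pM ?addr_ge0 ?cnorm_ge0//.
  have : eta <= 1 by rewrite ge_min lexx.
  have := cnormB x (x - y); rewrite subKr -/M; lra.
have nX j : 0 <= n%:R ^+ j :> R by rewrite exprn_ge0.
(* Pass from [x] to [star x] by normality, then to [star y], to [y] one level lower by [tr_star],
   and back to [x]; the two approximations cost at most [D] each on the larger scale. *)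
have step j : tr (k + j).+1 x <= tr (k + j) x + 2 * D * n%:R ^+ (k + j).+1.
  have -> : tr (k + j).+1 x = tr (k + j).+1 (star x).
    by apply: tr_eq; rewrite starK.
  have := tr_le_dist (k + j).+1 (star x) (star y).
  rewrite -starB !cnorm_starE (@tr_star _ (k + j) y); last first.
    exact: (homogeneous_widen j hy).
  have := tr_le_dist (k + j) y x; rewrite cdistC (addrC (cnorm y)).
  have := ler_wpM2r (nX (k + j)%N) xyD.
  have := ler_wpM2r (nX (k + j).+1) xyD.
  have : D * n%:R ^+ (k + j) <= D * n%:R ^+ (k + j).+1.
    rewrite ler_wpM2l ?ler_weXn2l ?ler1n 1?ltnW// /D mulr_ge0 ?ltW//; lra.
  lra.
(* After division by [n ^ (k + j)], [step] bounds each term by half the previous one plus [2 D],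
   since [n >= 2]; [4 D] is the fixed point of this recursion. *)
have claim j : tr (k + j) x <= (M ^+ 2 / 2 ^+ j + 4 * D) * n%:R ^+ (k + j).
  elim: j => [|j IH].
    have D0 : 0 <= D by rewrite mulr_ge0 ?ltW//; lra.
    rewrite addn0 expr0 divr1 (le_trans (tr_le _ _))// ler_wpM2r// -/M; lra.
  rewrite addnS (le_trans (step _))//.
  have a0 : 0 <= M ^+ 2 / 2 ^+ j by rewrite divr_ge0 ?exprn_ge0.
  have -> : M ^+ 2 / 2 ^+ j.+1 = M ^+ 2 / 2 ^+ j / 2.
    by rewrite (exprSr 2) invfM mulrA.
  have D0 : 0 <= D by rewrite mulr_ge0 ?ltW//; lra.
  have n2' : 0 <= (n%:R : R) - 2 by rewrite subr_ge0 ler_nat.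
  move: IH; set a := M ^+ 2 / 2 ^+ j in a0 *; set N := n%:R ^+ (k + j) => IH.
  have aD : 0 <= a / 2 + 2 * D by lra.
  have := mulr_ge0 (mulr_ge0 aD (nX (k + j)%N)) n2'.
  rewrite exprS -/N; lra.
(* Both terms of [claim] are to be at most [e / 2]; [D8] handles the second. *)
have [I HI] : exists I, M ^+ 2 / 2 ^+ I <= e / 2.
  have : M ^+ 2 / 2 ^+ m @[m --> \oo] --> (0 : R).
    rewrite -(mulr0 (M ^+ 2)); apply: cvgMr.
    under eq_fun do rewrite -exprVn; apply: cvg_expr.
    by rewrite ger0_norm ?invr_ge0//; lra.
  move=> /cvgrPdist_lt/(_ _ (divr_gt0 e0 (ltr0n _ 2)))[I _ HI]; exists I.
  have := HI _ (leqnn I); rewrite /= sub0r normrN => /ltW; exact/le_trans/ler_norm.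
exists (k + I)%N => j kj; rewrite -(subnKC (leq_trans (leq_addr _ _) kj)).
rewrite (le_trans (claim _))// ler_wpM2r//.
have : M ^+ 2 / 2 ^+ (j - k) <= M ^+ 2 / 2 ^+ I.
  rewrite ler_wpM2l ?exprn_ge0// lef_pV2 ?posrE ?exprn_gt0//.
  by rewrite ler_weXn2l ?ler1n// leq_subRL ?(leq_trans (leq_addr _ _) kj).
lra.
Qed.

Lemma normal_degree_one_eq0 x : (2 <= n)%N -> normal_elt x ->
  (forall e, 0 < e -> exists k y, homogeneous k.+1 k y /\ cnorm (x - y) <= e) ->
  x = 0.
Proof.
move=> n2 nx appr; have n0 : (0 < n)%N by exact: ltnW.
suff xx : star x * x = 0.
  by apply: cnorm_eq0; apply/eqP; rewrite -sqrf_eq0 -cnorm_star xx cnorm0.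
apply: null_eq0 => //; first exact/nullMl/normal_degree_one_null.
move=> e e0; have M0 := cnorm_ge0 x.
have M1 : 0 < 2 * cnorm x + 1 by lra.
pose eta := Num.min 1 (e / (2 * cnorm x + 1)).
have eta0 : 0 < eta by rewrite lt_min ltr01 divr_gt0.
have [k [y [hy xy]]] := appr _ eta0.
(* The bidegrees [(k, k.+1)] and [(k.+1, k)] compose to [(k, k)]. *)
exists k, (star y * y); split.
- exact: homogeneousM (homogeneous_star hy) hy.
- by rewrite starM starK.
have -> : star y * y - star x * x = star (y - x) * y + star x * (y - x).
  by rewrite starB mulrBl mulrBr addrA subrK.
have := cnormD (star (y - x) * y) (star x * (y - x)).
have := cnormM (star (y - x)) y; have := cnormM (star x) (y - x).
rewrite !cnorm_starE cdistC.
have eta1 : eta <= 1 by rewrite ge_min lexx.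
have : eta <= e / (2 * cnorm x + 1) by rewrite ge_min lexx orbT.
rewrite ler_pdivlMr//.
have := cnormB x (x - y); rewrite subKr => yx.
have y1 : cnorm y <= cnorm x + 1 by lra.
have := ler_wpM2l (cnorm_ge0 (x - y)) y1.
have := ler_wpM2r (ltW M1) xy.
lra.
Qed.

End CuntzFamily.

(** * Density of finite sums of homogeneous elements *)

Section HomogeneousSums.
Variables (R : realType) (n : nat) (A : cstarAlgType R) (S : 'I_n -> A).
Hypothesis cS : cuntz_family S.
Implicit Types (x y z u v w : A) (a : R[i]) (L M : seq (nat * nat)).

(** The list records one bidegree per summand, repetitions allowed, so that induction on it treats
    one component at a time. *)
Fixpoint homogeneous_sum_of L w : Prop :=
  if L is (p, q) :: L' then
    exists y v, [/\ homogeneous S p q y, homogeneous_sum_of L' v & w = y + v]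
  else w = 0.

Lemma homogeneous_sum_ofD L M w v :
  homogeneous_sum_of L w -> homogeneous_sum_of M v ->
  homogeneous_sum_of (L ++ M) (w + v).
Proof.
elim: L w => [|[p q] L IH] w /=; first by move=> -> hv; rewrite add0r.
move=> [y [u [hy hu ->]]] hv; exists y, (u + v).
by split=> //; [exact: IH|rewrite addrA].
Qed.

Lemma homogeneous_sum_ofZ L a w :
  homogeneous_sum_of L w -> homogeneous_sum_of L (a *: w).
Proof.
elim: L w => [|[p q] L IH] w /=; first by move=> ->; rewrite scaler0.
move=> [y [u [hy hu ->]]]; exists (a *: y), (a *: u).
by split; [exact: homogeneousZ|exact: IH|rewrite scalerDr].
Qed.

Lemma homogeneous_sum_of1 p q y :
  homogeneous S p q y -> homogeneous_sum_of [:: (p, q)] y.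
Proof. by move=> hy; exists y, 0; rewrite addr0. Qed.

Lemma homogeneous_sum_of_star L w :
  homogeneous_sum_of L w -> exists M, homogeneous_sum_of M (star w).
Proof.
elim: L w => [|[p q] L IH] w /=; first by move=> ->; exists [::]; rewrite /= star0.
move=> [y [u [hy /IH[M hu] ->]]]; exists ((q, p) :: M); rewrite starD.
by exists (star y), (star u); split=> //; exact: homogeneous_star.
Qed.

(** The factor with the shorter inner word is widened until the inner lengths agree. *)
Lemma homogeneous_mul p q r s y z :
  homogeneous S p q y -> homogeneous S r s z ->
  exists p' q', homogeneous S p' q' (y * z).
Proof.
move=> hy hz; have [qr|rq] := leqP q r.
  have := homogeneous_widen cS (r - q) hy; rewrite subnKC// => hy'.
  by exists (p + (r - q))%N, s; exact: homogeneousM hz.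
have := homogeneous_widen cS (q - r) hz; rewrite subnKC 1?ltnW// => hz'.
by exists p, (s + (q - r))%N; exact: homogeneousM hz'.
Qed.

Lemma homogeneous_sum_ofM L M w v :
  homogeneous_sum_of L w -> homogeneous_sum_of M v ->
  exists N, homogeneous_sum_of N (w * v).
Proof.
move=> + hv; elim: L w => [|[p q] L IH] w /=.
  by move=> ->; exists [::]; rewrite /= mul0r.
move=> [y [u [hy /IH[N hu] ->]]]; rewrite mulrDl.
suff [N' hyv] : exists N', homogeneous_sum_of N' (y * v).
  by exists (N' ++ N); exact: homogeneous_sum_ofD.
elim: M v hv {IH N hu} => [|[r s] M IH] v /=.
  by move=> ->; exists [::]; rewrite /= mulr0.
move=> [z [t [hz /IH[N ht] ->]]]; rewrite mulrDr.
have [p' [q' /homogeneous_sum_of1 hyz]] := homogeneous_mul hy hz.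
by eexists; exact: homogeneous_sum_ofD hyz ht.
Qed.

Lemma homogeneous_sums_closure : closed_star_subalgebra
  [set x : A | forall e : R, 0 < e ->
     exists w, (exists L, homogeneous_sum_of L w) /\ cnorm (x - w) < e].
Proof.
split=> /=.
- move=> e e0; exists 0; split; first by exists [::].
  by rewrite subrr cnorm0.
- move=> x y hx hy e e0; have e2 := divr_gt0 e0 (ltr0n _ 2).
  have [w [[L hw] xw]] := hx _ e2; have [v [[M hv] yv]] := hy _ e2.
  exists (w + v); split; first by eexists; exact: homogeneous_sum_ofD hw hv.
  by rewrite opprD addrACA (le_lt_trans (cnormD _ _))// (splitr e) ltrD.
- move=> a x hx e e0.
  have a1 : 0 < Normc.normc a + 1.
    by rewrite ltr_pwDr// /Normc.normc; case: (a) => b c; exact: sqrtr_ge0.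
  have [w [[L hw] xw]] := hx _ (divr_gt0 e0 a1).
  exists (a *: w); split; first by exists L; exact: homogeneous_sum_ofZ.
  rewrite -scalerBr cnormZE; move: xw; rewrite ltr_pdivlMr// mulrDr mulr1 mulrC.
  by apply: le_lt_trans; rewrite lerDl cnorm_ge0.
- move=> x y hx hy e e0.
  pose b := cnorm x + cnorm y + 1.
  have x0 := cnorm_ge0 x; have y0 := cnorm_ge0 y.
  have b0 : 0 < b by rewrite /b; lra.
  (* With [d <= 1] the approximant [v] has norm at most [cnorm y + 1], so the error is below
     [d * b <= e]. *)
  pose d := Num.min 1 (e / b).
  have d0 : 0 < d by rewrite lt_min ltr01 divr_gt0.
  have [w [[L hw] xw]] := hx _ d0; have [v [[M hv] yv]] := hy _ d0.
  exists (w * v); split; first exact: homogeneous_sum_ofM hw hv.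
  have -> : x * y - w * v = x * (y - v) + (x - w) * v.
    by rewrite mulrBl mulrBr addrA subrK.
  have := cnormD (x * (y - v)) ((x - w) * v).
  have := cnormM x (y - v); have := cnormM (x - w) v.
  have d1 : d <= 1 by rewrite ge_min lexx.
  have := cnormB y (y - v); rewrite subKr => vy.
  have v1 : cnorm v <= cnorm y + 1 by lra.
  have := ler_wpM2l (cnorm_ge0 (x - w)) v1.
  have := ler_wpM2l x0 (ltW yv).
  have y1 : 0 < cnorm y + 1 by lra.
  have : cnorm (x - w) * (cnorm y + 1) < d * (cnorm y + 1) by rewrite ltr_pM2r.
  have : d <= e / b by rewrite ge_min lexx orbT.
  rewrite ler_pdivlMr// /b; lra.
- move=> x hx e e0; have [w [[L hw] xw]] := hx _ e0.
  exists (star w); split; first exact: homogeneous_sum_of_star hw.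
  by rewrite -starB cnorm_starE.
- move=> x hx e e0; have e2 := divr_gt0 e0 (ltr0n _ 2).
  have [y hy xy] := hx _ e2; have [w [hw yw]] := hy _ e2.
  exists w; split=> //.
  by rewrite (le_lt_trans (cdist_tri y _ _))// (splitr e) ltrD.
Qed.

Lemma homogeneous_sums_dense x e : cstar_generated (range S) = [set: A] ->
  0 < e -> exists w, (exists L, homogeneous_sum_of L w) /\ cnorm (x - w) < e.
Proof.
move=> gen e0; have : cstar_generated (range S) x by rewrite gen.
move=> /(_ _ (conj homogeneous_sums_closure _)); apply=> //.
move=> _ [i _ <-] d d0; exists (S i); split; last by rewrite subrr cnorm0.
by eexists; apply/homogeneous_sum_of1/(homogeneousS cS).
Qed.

End HomogeneousSums.

(** * Roots on the unit circle *)

Lemma conj_circle (R : realType) (z : circle R) :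
  ((val z)^*)%R = (val z)^-1.
Proof. by rewrite invC_norm (eqP (valP z)) expr1n invr1 mul1r. Qed.

Lemma circle_root_N1 (R : realType) m : (0 < m)%N ->
  exists z : circle R, val z ^+ m = -1.
Proof.
move=> m0; have zP : `|m.-root (-1 : R[i])| == 1.
  by rewrite norm_rootC normrN1 rootC1.
by exists (Circle zP); rewrite /= rootCK.
Qed.

(** A root of [-1] whose order is the distance between [p] and [q] does it. *)
Lemma circle_expr_opp (R : realType) p q : p != q ->
  exists z : circle R, val z ^+ p = - val z ^+ q.
Proof.
rewrite neq_ltn => /orP[] pq; move: (pq);
  rewrite -subn_gt0 => /(@circle_root_N1 R)[z zN1]; exists z.
  by rewrite -[in RHS](subnKC (ltnW pq)) exprD zN1 mulrN1 opprK.
by rewrite -[in LHS](subnKC (ltnW pq)) exprD zN1 mulrN1.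
Qed.

(** * The gauge action and the approximation of degree-one elements *)

Section Gauge.
Variables (R : realType) (n : nat) (A : cstarAlgType R) (S : 'I_n -> A).
Hypothesis cS : cuntz_family S.
Variable alpha : cstar_action (circle R) A.
Hypothesis gauge : is_gauge_action S alpha.
Implicit Types (x y u v w : A) (z : circle R).

(** Each left letter contributes [z], each right letter its conjugate, which is the inverse of
    [z]. *)
Lemma gauge_homogeneous p q y z : homogeneous S p q y ->
  alpha z y = (val z ^+ p / val z ^+ q) *: y.
Proof.
elim: p y => [|p IH] y hy.
  elim: q y hy => [|q IH] y hy.
    by have [c ->] := hy; rewrite divr1 scale1r linearZ_LR rmorph1.
  rewrite [y in LHS](cuntz_expandr cS) [y in RHS](cuntz_expandr cS).
  rewrite linear_sum scaler_sumr; apply: eq_bigr => j _.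
  rewrite rmorphM /= IH// act_star gauge starZ conj_circle.
  by rewrite -scalerAl -scalerAr scalerA exprSr invfM mulrA.
rewrite [y in LHS](cuntz_expandl cS) [y in RHS](cuntz_expandl cS).
rewrite linear_sum scaler_sumr; apply: eq_bigr => j _.
rewrite rmorphM /= (IH _ (hy j)) gauge.
by rewrite -scalerAl -scalerAr scalerA exprS -[in RHS]mulrA.
Qed.

(** A two-point average standing in for the integral that projects onto degree one: it is
    contractive, fixes degree one, and for a suitable [z] kills any one other given degree. *)
Definition twist z y : A := 2^-1%:C *: (y + (val z)^-1 *: alpha z y).

Lemma twistD z y w : twist z (y + w) = twist z y + twist z w.
Proof. by rewrite /twist -scalerDr addrACA -scalerDr -rmorphD. Qed.

Lemma twistB z y w : twist z (y - w) = twist z y - twist z w.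
Proof.
by rewrite -[in RHS](subrK w y) [in RHS]twistD addrK.
Qed.

Lemma cnorm_twist_le z y : cnorm (twist z y) <= cnorm y.
Proof.
rewrite cnormZr ger0_norm ?invr_ge0//.
have := cnormD y ((val z)^-1 *: alpha z y).
rewrite [cnorm (_^-1 *: _)]cnormZ1; last by rewrite normfV (eqP (valP z)) invr1.
have := star_morphism_contractive (act_star alpha z) y; lra.
Qed.

Lemma twist_homogeneous p q y z : homogeneous S p q y ->
  twist z y = (2^-1%:C * (1 + val z ^+ p / val z ^+ q.+1)) *: y.
Proof.
move=> hy; rewrite /twist (gauge_homogeneous _ hy) -[RHS]scalerA scalerDl scale1r.
by rewrite scalerA exprS invfM mulrCA.
Qed.

Lemma twist_degree_one k y z : homogeneous S k.+1 k y -> twist z y = y.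
Proof.
move=> hy; rewrite (twist_homogeneous _ hy) divff ?expf_neq0 ?circle_neq0//.
by rewrite mulrDr mulr1 -rmorphD/= -splitr1 scale1r.
Qed.

Lemma twist_sum L z w : homogeneous_sum_of S L w ->
  homogeneous_sum_of S L (twist z w).
Proof.
elim: L w => [|[p q] L IH] w /=.
  by move=> ->; rewrite /twist rmorph0 scaler0 addr0 scaler0.
move=> [y [u [hy hu ->]]]; exists (twist z y), (twist z u).
split; [|exact: IH|exact: twistD].
by rewrite (twist_homogeneous _ hy); exact: homogeneousZ.
Qed.

Variable x : A.
Hypothesis x_degree_one : forall z, alpha z x = val z *: x.

Lemma twist_fixed z : twist z x = x.
Proof.
rewrite /twist x_degree_one scalerA mulVf ?circle_neq0// scale1r.
by rewrite scalerDr -scalerDl -rmorphD/= -splitr1 scale1r.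
Qed.

(* Averaging with [z^(p-q-1) = -1] kills the component of bidegree [(p, q)]. *)
Lemma degree_one_component L w k y : homogeneous S k.+1 k y ->
  homogeneous_sum_of S L w ->
  exists l v, homogeneous S l.+1 l v /\ cnorm (x - v) <= cnorm (x - (y + w)).
Proof.
elim: L w k y => [|[p q] L IH] w k y hy /=.
  by move=> ->; exists k, y; rewrite addr0.
move=> [u [v [hu hv ->]]].
have [pq|pq] := eqVneq p q.+1.
  (* A component of degree one is merged into [y] once both are widened to a common bidegree. *)
  rewrite addrA; apply: (IH _ (k + q)%N) => //.
  apply: homogeneousD; first exact: (homogeneous_widen cS q hy).
  rewrite pq in hu; have := homogeneous_widen cS k hu.
  by rewrite addnC -addnS addnC [(q + k)%N]addnC addSn addnC.
have [z zpq] := circle_expr_opp R pq.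
(* The twist merely rescales the remaining components, so their list [L] is unchanged; as it fixes
   [x] and contracts, the distance to [x] does not grow. *)
have [l [t [ht xt]]] := IH _ _ _ hy (twist_sum z hv).
exists l, t; split=> //; apply: (le_trans xt); apply: le_trans (cnorm_twist_le z _).
rewrite twistB twist_fixed !twistD (twist_degree_one _ hy) (twist_homogeneous _ hu).
by rewrite zpq mulNr divff ?expf_neq0 ?circle_neq0// subrr mulr0 scale0r add0r.
Qed.

Lemma degree_one_approx e : cstar_generated (range S) = [set: A] -> 0 < e ->
  exists k y, homogeneous S k.+1 k y /\ cnorm (x - y) <= e.
Proof.
move=> gen e0; have [w [[L hw] xw]] := homogeneous_sums_dense cS x gen e0.
have [k [y [hy xy]]] := @degree_one_component L w 0%N 0 (homogeneous0 S 1 0) hw.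
by exists k, y; split=> //; rewrite (le_trans xy)// add0r ltW.
Qed.

End Gauge.

(** * Functions on the cone over the circle *)

Lemma real_complex_continuous (R : realType) :
  continuous (real_complex R : R -> R[i]).
Proof.
move=> x; apply/cvgrPdist_lt => /= e e0.
have eE : e = (complex.Re e)%:C by rewrite RRe_real// gtr0_real.
have e1 : 0 < complex.Re e by rewrite -ltcR -eE.
near=> y.
rewrite -rmorphB normc_def /= expr0n/= addr0 sqrtr_sqr eE ltcR.
near: y; exact: cvgr_dist_lt.
Unshelve. all: by end_near.
Qed.

Section ConeFunctions.
Variable R : realType.

Lemma half_open_val_continuous :
  continuous (fun s : half_open_unit R => val s).
Proof. exact: initial_continuous. Qed.

(** The set stays away from the missing endpoint: a filter on it, pushed forward to the line,
    clusters at some [c >= e], and this point lifts because the topology is initial. *)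
Lemma half_open_ge_compact (e : R) : 0 < e ->
  compact [set s : half_open_unit R | e <= val s].
Proof.
move=> e0 F PF Fe.
pose V (s : half_open_unit R) : R := val s.
have VF : F (V @^-1` `[e, 1]%classic).
  apply: filterS Fe => s es; rewrite /= in_itv /= (es : e <= V s) /=.
  by have := set_valP s; rewrite /= in_itv /= => /andP[].
have [c [ec cF]] := @segment_compact R e 1 (V @ F) _ VF.
have c01 : (`]0, 1]%classic : set R) c.
  move: ec; rewrite /= !in_itv /= => /andP[ec ->].
  by rewrite (lt_le_trans e0 ec).
exists (exist _ c (mem_set c01)); split.
  by move: ec; rewrite /= in_itv /= => /andP[].
move=> P Q FP; rewrite nbhsE /= => -[Q' [[U oU UQ'] Q'c] Q'Q].
have FV : F (V @^-1` [set V s | s in P]).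
  by apply: filterS FP => s Ps; exists s.
have Uc : nbhs c U by apply: open_nbhs_nbhs; split=> //; move: Q'c; rewrite -UQ'.
have [r [[s Ps sr] Ur]] := cF _ _ FV Uc.
by exists s; split=> //; apply: Q'Q; rewrite -UQ' /=; rewrite -sr in Ur.
Qed.

Lemma half_open_id_vanishing : C_vanishing (@half_open_id R).
Proof.
split.
  move=> s; apply: (cvg_comp _ (real_complex R)).
    exact: half_open_val_continuous.
  exact: real_complex_continuous.
move=> e e0; exists [set s | e <= val s]; first exact: half_open_ge_compact.
move=> s /= /negP; rewrite -ltNge /half_open_id => se.
have := set_valP s; rewrite /= in_itv /= => /andP[s0 _].
by rewrite ger0_norm ?ltcR// lecR ltW.
Qed.

Lemma cone_pure_tensor (G : compactGroupType) (f : half_open_unit R -> R[i])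
    (g : G -> R[i]) : C_vanishing f -> continuous g ->
  cone_tensor (pure_tensor f g).
Proof.
move=> hf hg; apply: subset_closure; exists 1%N, (fun=> f), (fun=> g).
by split=> //; apply/funext => p; rewrite big_ord1.
Qed.

End ConeFunctions.

Lemma conj_circle_continuous (R : realType) :
  continuous (fun z : circle R => ((circle_val z)^*)%R).
Proof.
rewrite (_ : (fun z => _) = fun z : circle R => (circle_val z)^-1).
  by move=> z; exact: (cvgV (circle_neq0 z) (@circle_val_continuous R z)).
by apply/funext => z; exact: conj_circle.
Qed.

(** * Infinite weak local-triviality dimension *)

Section InfiniteDimension.
Variables (R : realType) (A : cstarAlgType R).
Variable alpha : cstar_action (circle R) A.
Hypothesis no_normal : forall x : A, normal_elt x ->
  (forall z : circle R, alpha z x = circle_val z *: x) -> x = 0.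

Lemma equivariant_cone_hom_eq0 (rho : (half_open_unit R * circle R -> R[i]) -> A) :
  star_hom_on (@cone_tensor R (circle R)) rho ->
  (forall g f, cone_tensor f -> rho (second_translate g f) = alpha g (rho f)) ->
  rho (pure_tensor (@half_open_id R) (fun=> 1)) = 0.
Proof.
move=> hrho equiv; set t := @half_open_id R.
have ht := @half_open_id_vanishing R.
pose f := pure_tensor t (@circle_val R).
pose f' := pure_tensor t (fun z : circle R => ((circle_val z)^*)%R).
pose k := pure_tensor t (fun _ : circle R => (1 : R[i])).
have hf : cone_tensor f by apply: cone_pure_tensor => //; exact: circle_val_continuous.
have hf' : cone_tensor f' by apply: cone_pure_tensor => //; exact: conj_circle_continuous.
have hk : cone_tensor k by apply: (cone_pure_tensor ht); exact: cst_continuous.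
have tJ s : ((t s)^*)%R = t s by exact: conjc_real.
have f'E : rho f' = star (rho f).
  rewrite -(star_homJ hrho)//; congr rho; apply/funext => p.
  by rewrite /f' /f /pure_tensor rmorphM; congr (_ * _); exact/esym/tJ.
have kE : rho k = star (rho k).
  rewrite -(star_homJ hrho)//; congr rho; apply/funext => p.
  by rewrite /k /pure_tensor rmorphM rmorph1; congr (_ * _); exact/esym/tJ.
have fx : rho f = 0.
  apply: no_normal.
    rewrite /normal_elt -f'E -!(star_homM hrho)//.
    by congr rho; apply/funext => p; rewrite mulrC.
  (* Translating the circle coordinate by [z] multiplies [f] by [z], hence [rho f] has degree
     one. *)
  move=> z; rewrite -equiv// -(star_homZ hrho)//.
  congr rho; apply/funext => p.
  by rewrite /second_translate /f /pure_tensor /= mulrA mulrC.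
(* On the circle [|z| = 1], so [k * k = f * f'] pointwise; the self-adjoint [rho k] then has square
   zero. *)
have kk : rho k * rho k = 0.
  rewrite -(star_homM hrho)// -[RHS](mul0r (rho f')) -fx -(star_homM hrho)//.
  congr rho; apply/funext => p; rewrite /k /f /f' /pure_tensor !mulr1.
  rewrite mulrACA -normCK (eqP (circle_valP p.2)) expr1n mulr1//.
by apply: cnorm_eq0; apply/eqP; rewrite -sqrf_eq0 -cnorm_star -kE kk cnorm0.
Qed.

(** For every [m] the required sum is 0, which is not invertible, so the infimum runs over the empty
    set. *)
Lemma dim_WLT_infinite : dim_WLT alpha = +oo%E.
Proof.
rewrite /dim_WLT (_ : [set _ | _ in _] = set0) ?ereal_inf0//.
rewrite -subset0 => t [m [rho [hrho equiv [y [+ _]]]] _].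
rewrite big1 => [|i _]; last first.
  by apply: (equivariant_cone_hom_eq0 (hrho i)) => g f; exact: equiv.
by rewrite mul0r => /esym/eqP; rewrite oner_eq0.
Qed.

End InfiniteDimension.

Theorem proposition5p1 (R : realType) (n : nat) (hn : (2 <= n)%N)
    (On : cstarAlgType R) (S : 'I_n -> On) (hS : is_cuntz_algebra S)
    (alpha : cstar_action (circle R) On) (halpha : is_gauge_action S alpha) :
  (forall x : On, normal_elt x ->
     (forall z : circle R, alpha z x = circle_val z *: x) -> x = 0) /\
  dim_WLT alpha = +oo%E.
Proof.
have [cS gen _] := hS.
have no_normal x : normal_elt x ->
    (forall z, alpha z x = circle_val z *: x) -> x = 0.
  move=> nx hx; apply: (normal_degree_one_eq0 cS hn nx) => e.
  exact: (degree_one_approx cS halpha hx gen).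
by split=> //; exact: dim_WLT_infinite.
Qed.
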